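(* Let $S$ be a compact Hausdorff space and let $T\colon C(S)\to C(S)$ be a bounded linear operator with representing kernel $(\mu_s)_{s\in S}$. If $$\sup_{s\in U}\mu_s(\{s\})\ \ge\ 0\qquad\text{for all nonempty open sets } U\subset S,$$ then $$\|\mathrm{Id}+T\| = 1+\|T\|.$$ In fact, the equality $\|\mathrm{Id}+T\|=1+\|T\|$ holds if and only if $$\sup\bigl\{\mu_s(\{s\}) : s\in S,\ \|\mu_s\|>\|T\|-\varepsilon\bigr\}\ \ge\ 0\qquad\text{for every }\varepsilon>0.$$
   Context: Compact Hausdorff spaces are nonempty. Scalars are real: $C(S)$ is the real Banach space of continuous functions $S\to\mathbb{R}$ with the supremum norm, and $M(S)\cong C(S)^*$ is the space of finite signed regular Borel measures on $S$ with the total variation norm. $\mathrm{Id}$ is the identity operator and operators carry the operator norm. The representing kernel of a bounded linear operator $T\colon C(S)\to C(S)$ is the family $(\mu_s)_{s\in S}$ in $M(S)$ given by $\mu_s=T^*\delta_s$, where $\delta_s$ is the Dirac measure at $s$; that is, $\int_S f\,d\mu_s=(Tf)(s)$ for all $f\in C(S)$ and $s\in S$. *)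

(* Defs.v *)
From HB Require Import structures.
From mathcomp Require Import all_boot all_order all_algebra.
From mathcomp Require Import all_classical all_reals all_analysis.

Set Implicit Arguments.
Unset Strict Implicit.
Unset Printing Implicit Defensive.

Import Order.TTheory GRing.Theory Num.Theory.
Import numFieldNormedType.Exports.

Local Open Scope classical_set_scope.
Local Open Scope ring_scope.

(* The point carried by the structure records nonemptiness. It is also what
   `g_sigma_algebraType` needs in order to produce a measurable type. *)
HB.mixin Record isCompactHausdorff S & PointedTopological S := {
  compact_space : compact [set: S];
  hausdorff_sep : hausdorff_space S
}.

#[short(type="compactHausdorffType")]
HB.structure Definition CompactHausdorff :=
  {S of isCompactHausdorff S & PointedTopological S}.

Definition cfun (S : compactHausdorffType) (R : realType) : Type :=
  continuousType S R.

Section cfun_lmodule.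
Context (S : compactHausdorffType) (R : realType).
Implicit Types f g h : cfun S R.

HB.instance Definition _ := Choice.on (cfun S R).

Lemma cfunP f g : (forall x, f x = g x) -> f = g.
Proof. by move=> fg; apply/continuousEP. Qed.

Lemma cfun_continuous f : continuous f.
Proof. exact: cts_fun. Qed.

Definition cfun_cst (a : R) : cfun S R :=
  mkcts (@cst_continuous S R a).

Fact cfun_add_subproof f g : continuous (fun x => f x + g x).
Proof. by move=> x; apply: cvgD; exact: cfun_continuous. Qed.
Definition cfun_add f g : cfun S R := mkcts (@cfun_add_subproof f g).

Fact cfun_opp_subproof f : continuous (fun x => - f x).
Proof. by move=> x; apply: cvgN; exact: cfun_continuous. Qed.
Definition cfun_opp f : cfun S R := mkcts (@cfun_opp_subproof f).

Fact cfun_scale_subproof (a : R) f : continuous (fun x => a * f x).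
Proof. by move=> x; apply: cvgM; [exact: cvg_cst|exact: cfun_continuous]. Qed.
Definition cfun_scale (a : R) f : cfun S R := mkcts (@cfun_scale_subproof a f).

Fact cfun_addA : associative cfun_add.
Proof. by move=> f g h; apply: cfunP => x /=; exact: addrA. Qed.
Fact cfun_addC : commutative cfun_add.
Proof. by move=> f g; apply: cfunP => x /=; exact: addrC. Qed.
Fact cfun_add0 : left_id (cfun_cst 0) cfun_add.
Proof. by move=> f; apply: cfunP => x /=; exact: add0r. Qed.
Fact cfun_addN : left_inverse (cfun_cst 0) cfun_opp cfun_add.
Proof. by move=> f; apply: cfunP => x /=; exact: addNr. Qed.

HB.instance Definition _ := GRing.isZmodule.Build (cfun S R)
  cfun_addA cfun_addC cfun_add0 cfun_addN.

Fact cfun_scaleA a b f :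
  cfun_scale a (cfun_scale b f) = cfun_scale (a * b) f.
Proof. by apply: cfunP => x /=; exact: mulrA. Qed.
Fact cfun_scale1 : left_id 1 cfun_scale.
Proof. by move=> f; apply: cfunP => x /=; exact: mul1r. Qed.
Fact cfun_scaleDr : right_distributive cfun_scale +%R.
Proof. by move=> a f g; apply: cfunP => x /=; exact: mulrDr. Qed.
Fact cfun_scaleDl f : {morph cfun_scale^~ f : a b / a + b}.
Proof. by move=> a b; apply: cfunP => x /=; exact: mulrDl. Qed.

HB.instance Definition _ := GRing.Zmodule_isLmodule.Build R (cfun S R)
  cfun_scaleA cfun_scale1 cfun_scaleDr cfun_scaleDl.

Lemma cfunDE f g x : (f + g) x = f x + g x. Proof. by []. Qed.
Lemma cfunNE f x : (- f) x = - f x. Proof. by []. Qed.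
Lemma cfun0E x : (0 : cfun S R) x = 0. Proof. by []. Qed.
Lemma cfunZE a f x : (a *: f) x = a * f x. Proof. by []. Qed.

End cfun_lmodule.

Section cfun_norm.
Context (S : compactHausdorffType) (R : realType).
Implicit Types f g : cfun S R.

Definition supnorm f : R := sup (range (fun x => `|f x|)).

Lemma has_sup_supnorm f : has_sup (range (fun x => `|f x|)).
Proof.
split; first by exists `|f point|, point.
have /compact_bounded [M [_ Mf]] : compact (f @` [set: S]).
  apply: continuous_compact; last exact: compact_space.
  by apply: continuous_subspaceT; exact: cfun_continuous.
exists (M + 1) => _ [x _ <-].
by apply: (Mf (M + 1)); [rewrite ltrDl|exists x].
Qed.

Lemma le_supnorm f x : `|f x| <= supnorm f.
Proof. by apply: ub_le_sup; [have [] := has_sup_supnorm f|exists x]. Qed.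

Lemma supnorm_le f M : (forall x, `|f x| <= M) -> supnorm f <= M.
Proof.
move=> fM; apply: ge_sup; first by have [] := has_sup_supnorm f.
by move=> _ [x _ <-].
Qed.

Fact supnormD f g : supnorm (f + g) <= supnorm f + supnorm g.
Proof.
apply: supnorm_le => x; apply: le_trans (ler_normD _ _) _.
by apply: lerD; exact: le_supnorm.
Qed.

Fact supnormZ (a : R) f : supnorm (a *: f) = `|a| * supnorm f.
Proof.
have le b h : supnorm (b *: h) <= `|b| * supnorm h.
  apply: supnorm_le => x; rewrite cfunZE normrM.
  by apply: ler_wpM2l => //; exact: le_supnorm.
apply/eqP; rewrite eq_le le /=; have [->|a0] := eqVneq a 0.
  by rewrite normr0 mul0r; apply: le_trans (le_supnorm _ point).
rewrite -ler_pdivlMl ?normr_gt0// -normfV.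
by apply: le_trans (le _ _); rewrite scalerA mulVf// scale1r.
Qed.

Fact supnorm0_eq0 f : supnorm f = 0 -> f = 0.
Proof.
move=> f0; apply: cfunP => x; apply/eqP.
by rewrite cfun0E -normr_le0 -f0; exact: le_supnorm.
Qed.

HB.instance Definition _ := @Lmodule_isNormed.Build R (cfun S R)
  supnorm supnormD supnormZ supnorm0_eq0.

Lemma cfun_normE f : `|f| = sup (range (fun x => `|f x|)).
Proof. by []. Qed.

End cfun_norm.

(* Only meaningful for bounded linear maps: `sup` is 0 on unbounded sets. *)
Definition opnorm (R : realType) (V W : normedModType R) (T : V -> W) : R :=
  sup [set `|T f| | f in [set f : V | `|f| <= 1]].

Notation borelType S := (g_sigma_algebraType (@open S)).

Section signed_measure.
Context (S : compactHausdorffType) (R : realType).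
Variable nu : {charge set (borelType S) -> \bar R}.

Definition hahn_pos : set (borelType S) :=
  projT1 (cid (Hahn_decomposition nu)).
Definition hahn_neg : set (borelType S) :=
  projT1 (cid (projT2 (cid (Hahn_decomposition nu)))).
Definition hahnP : hahn_decomposition nu hahn_pos hahn_neg :=
  projT2 (cid (projT2 (cid (Hahn_decomposition nu)))).

(* None of the notions below depends on the Hahn decomposition chosen, see
   `Hahn_decomposition_uniq`. *)
Definition total_variation : {measure set (borelType S) -> \bar R} :=
  charge_variation hahnP.

(* Real-valued because charges are finite. *)
Definition tvnorm : R := fine (total_variation [set: S]).

Definition regular_charge : Prop :=
  forall A : set (borelType S), measurable A -> forall e : R, 0 < e ->
  exists K U : set S, [/\ compact K, open U, K `<=` A, A `<=` U &
    (total_variation (U `\` K) < e%:E)%E].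

Definition charge_integral (f : S -> R) : R :=
  \int[jordan_pos hahnP]_x f x - \int[jordan_neg hahnP]_x f x.

End signed_measure.

(* mu s is the adjoint of T applied to the Dirac measure at s, under the Riesz
   identification of the dual of C(S) with the regular Borel charges. *)
Definition representing_kernel (S : compactHausdorffType) (R : realType)
    (T : cfun S R -> cfun S R)
    (mu : S -> {charge set (borelType S) -> \bar R}) : Prop :=
  (forall s, regular_charge (mu s)) /\
  (forall s (f : cfun S R), charge_integral (mu s) f = T f s).

(* Main.v *)
Require Import Defs.
From HB Require Import structures.
From mathcomp Require Import all_boot all_order all_algebra.
From mathcomp Require Import all_classical all_reals all_analysis.
From mathcomp Require Import ring lra.

(** Everything follows from one formula. For every real [c], the operator
    [c Id + T] sends [f] to [s |-> c f(s) + \int f d mu_s], so its value at [s]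
    is a functional represented by [c delta_s + mu_s], whose total variation is
    [|c + a_s| + (||mu_s|| - |a_s|)] with [a_s = mu_s({s})]: only the mass of
    the atom at [s] changes. Hence ([lt_opnorm_scale_addP])
    [||c Id + T|| = sup_s (|c + a_s| + ||mu_s|| - |a_s|)].
    The case [c = 0] gives [||T|| = sup_s ||mu_s||]; the case [c = 1] gives
    [||Id + T||].

    The bound from above ([charge_integral_le]) separates the atom at [s] from
    the rest of the integral. The bound from below ([charge_integral_approx])
    needs a nearly optimal continuous [f]: by regularity the positive and the
    negative Hahn sets, deprived of [s], are filled up to a small mass by compact
    sets [K] and [L], and Urysohn's lemma provides [f] with values in [[-1, 1]],
    equal to [1] on [K], to [-1] on [L], and at [s] to the sign of [c + a_s].

    Now [|1 + a| - |a| <= 1], and this number is close to [1] exactly when [a] is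
    not much below [0]. Therefore [||Id + T|| = 1 + ||T||] if and only if there
    are points [s] where [||mu_s||] is almost [||T||] and [a_s] is almost
    nonnegative ([opnorm_add_eqP]), which is the second criterion. The first
    criterion implies it because each set [||mu_s|| > ||T|| - eps] contains a
    nonempty open set [|T f| > ||T|| - eps] with [|f| <= 1]. *)

Set Implicit Arguments.
Unset Strict Implicit.
Unset Printing Implicit Defensive.

Import Order.TTheory GRing.Theory Num.Theory.
Import numFieldNormedType.Exports.

Local Open Scope classical_set_scope.
Local Open Scope ring_scope.

(** * Integrals of functions constant on two sets *)

(** Off [A] and [B] only the bound [|f| <= 1] is used, which costs at most the
    mass left over; this single estimate serves the bounds from above and from
    below. *)
Lemma dist_Rintegral_two_values d (X : measurableType d) (R : realType)
    (m : {finite_measure set X -> \bar R}) (f : X -> R) (A B : set X) (k l : R) :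
  m.-integrable setT (EFin \o f) -> (forall x, `|f x| <= 1) ->
  measurable A -> measurable B -> [disjoint A & B] ->
  (forall x, A x -> f x = k) -> (forall x, B x -> f x = l) ->
  `|\int[m]_x f x - (k * fine (m A) + l * fine (m B))|
    <= fine (m setT) - fine (m A) - fine (m B).
Proof.
move=> intf f1 mA mB AB fA fB.
have mAB : measurable (A `|` B) by exact: measurableU.
have mC := measurableC mAB.
have intD (D : set X) : measurable D -> m.-integrable D (EFin \o f).
  by move=> mD; exact: integrableS intf.
have sumC (g : X -> R) : m.-integrable setT (EFin \o g) ->
    \int[m]_x g x = \int[m]_(x in A) g x + \int[m]_(x in B) g x
      + \int[m]_(x in ~` (A `|` B)) g x.
  move=> ig; rewrite -(setUv (A `|` B)) Rintegral_setU//; last 2 first.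
  - by rewrite setUv.
  - by apply/disj_setPS; rewrite setICr.
  rewrite Rintegral_setU//; exact: integrableS ig.
have i1 : m.-integrable setT (EFin \o (cst 1 : X -> R)).
  exact: finite_measure_integrable_cst.
have -> : fine (m setT) - fine (m A) - fine (m B) = fine (m (~` (A `|` B))).
  have := sumC _ i1; rewrite !Rintegral_cst// !mul1r; lra.
rewrite sumC// (@eq_Rintegral _ _ _ m A (cst k)); last first.
  by move=> x /set_mem /fA.
rewrite (@eq_Rintegral _ _ _ m B (cst l)); last by move=> x /set_mem /fB.
rewrite !Rintegral_cst// addrAC subrr add0r.
apply: le_trans (le_normr_Rintegral mC (intD _ mC)) _.
rewrite -[leRHS]mul1r -Rintegral_cst//; apply: le_Rintegral => //.
- exact: integrable_norm (intD _ mC).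
- exact: integrableS i1.
Qed.

(** * Continuous functions and Borel charges *)

Section borel.
Context (S : compactHausdorffType) (R : realType).
Implicit Types (f : cfun S R) (s : S).

Lemma borel_open (U : set S) : open U -> measurable (U : set (borelType S)).
Proof. exact: sub_sigma_algebra. Qed.

Lemma borel_closed (K : set S) : closed K -> measurable (K : set (borelType S)).
Proof.
move=> cK; rewrite -(setCK K); apply: measurableC.
by apply: borel_open; rewrite openC.
Qed.

Lemma closed_set1 (s : S) : closed [set s].
Proof. exact/accessible_closed_set1/hausdorff_accessible/hausdorff_sep. Qed.

Lemma borel_set1 (s : S) : measurable ([set s] : set (borelType S)).
Proof. by apply: borel_closed; exact: closed_set1. Qed.

Lemma borel_cfun f : measurable_fun [set: borelType S] (f : borelType S -> R).
Proof.
apply: (measurability _ (measurable_realfun.RGenOpens.measurableE R)).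
move=> _ [_ [a [b ->]] <-]; rewrite setTI; apply: borel_open.
have /continuousP cf := @cfun_continuous _ _ f.
exact/cf/interval_open.
Qed.

Lemma cfun_integrable (m : {finite_measure set (borelType S) -> \bar R}) f :
  m.-integrable setT (EFin \o f).
Proof.
apply: measurable_bounded_integrable => //.
- by rewrite -ge0_fin_numE// fin_num_measure.
- exact: borel_cfun.
- exists `|f|; split; first exact: num_real.
  by move=> M fM x _; exact: le_trans (le_supnorm f x) (ltW fM).
Qed.

End borel.

(** * The functional represented by a charge and an atom *)

Section jordan.
Context (S : compactHausdorffType) (R : realType)
  (nu : {charge set (borelType S) -> \bar R}).
Implicit Types (f : cfun S R) (s : S) (A : set (borelType S)).

Local Notation pos := (jordan_pos (hahnP nu)).
Local Notation neg := (jordan_neg (hahnP nu)).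
Local Notation P := (hahn_pos nu).
Local Notation N := (hahn_neg nu).

Lemma measurable_hahn_pos : measurable P.
Proof. by have [[]] := hahnP nu. Qed.

Lemma measurable_hahn_neg : measurable N.
Proof. by have [_ []] := hahnP nu. Qed.

Lemma jordan_pos_disjoint A : measurable A -> A `&` P = set0 -> pos A = 0%E.
Proof.
move=> mA AP.
by rewrite jordan_posE cjordan_posE /crestr0 mem_set// /crestr AP charge0.
Qed.

Lemma jordan_neg_disjoint A : measurable A -> A `&` N = set0 -> neg A = 0%E.
Proof.
move=> mA AN.
by rewrite jordan_negE cjordan_negE /crestr0 mem_set// /crestr AN charge0 oppe0.
Qed.

(** A point lies in only one of the two Hahn sets. *)
Lemma jordan_set1_eq0 s : fine (pos [set s]) = 0 \/ fine (neg [set s]) = 0.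
Proof.
have [_ _ _ PN0] := hahnP nu.
have [Ps|nPs] := pselect (P s); [right|left].
- rewrite jordan_neg_disjoint//; first exact: borel_set1.
  by apply/disjoints_subset => _ -> Ns; have : (P `&` N) s by []; rewrite PN0.
- rewrite jordan_pos_disjoint//; first exact: borel_set1.
  by apply/disjoints_subset => _ ->.
Qed.

Lemma fine_jordan A : measurable A ->
  fine (nu A) = fine (pos A) - fine (neg A).
Proof.
move=> mA; rewrite (jordan_decomp (hahnP nu) mA) /cadd/= cscaleN1.
by rewrite fineD ?fineN// ?fin_numN fin_num_measure.
Qed.

Lemma tvnorm_jordan : tvnorm nu = fine (pos setT) + fine (neg setT).
Proof. by rewrite /tvnorm/= /charge_variation fineD// fin_num_measure. Qed.

Lemma norm_atom s :
  `|fine (nu [set s])| = fine (pos [set s]) + fine (neg [set s]).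
Proof.
rewrite fine_jordan; last exact: borel_set1.
have p0 : 0 <= fine (pos [set s]) by rewrite fine_ge0.
have n0 : 0 <= fine (neg [set s]) by rewrite fine_ge0.
have [e0|e0] := jordan_set1_eq0 s; rewrite e0.
- by rewrite !add0r normrN ger0_norm.
- by rewrite subr0 addr0 ger0_norm.
Qed.

(** The right-hand side is the total variation of [c delta_s + nu]: adding
    [c delta_s] changes the mass of the atom at [s] and nothing else. *)
Lemma charge_integral_le (c : R) f s : (forall x, `|f x| <= 1) ->
  `|c * f s + charge_integral nu f| <=
    `|c + fine (nu [set s])| + (tvnorm nu - `|fine (nu [set s])|).
Proof.
move=> f1; rewrite norm_atom tvnorm_jordan fine_jordan; last exact: borel_set1.
have est (m : {finite_measure set (borelType S) -> \bar R}) :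
    `|\int[m]_x f x - f s * fine (m [set s])| <= fine (m setT) - fine (m [set s]).
  have := @dist_Rintegral_two_values _ _ _ m f set0 [set s] 0 (f s)
    (cfun_integrable m f) f1 measurable0 (borel_set1 s).
  rewrite measure0 /= mulr0 add0r subr0; apply => //; last by move=> x ->.
  by apply/disj_setPS; rewrite set0I.
rewrite /charge_integral.
have := est pos; have := est neg.
set Ip := \int[pos]_x f x; set In := \int[neg]_x f x.
set p := fine (pos [set s]); set n := fine (neg [set s]) => En Ep.
have -> : c * f s + (Ip - In) =
  f s * (c + (p - n)) + ((Ip - f s * p) - (In - f s * n)) by ring.
apply: le_trans (ler_normD _ _) _; apply: lerD.
  by rewrite normrM ler_piMl.
apply: le_trans (ler_normB _ _) _; lra.
Qed.

Lemma norm_charge_integral_le f : (forall x, `|f x| <= 1) ->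
  `|charge_integral nu f| <= tvnorm nu.
Proof.
move=> /(charge_integral_le 0 point).
by rewrite mul0r !add0r [leRHS]addrC subrK.
Qed.

Hypothesis nu_reg : regular_charge nu.

(** Meant for [m] a Jordan part of [nu] and [Q] the Hahn set carrying it. The
    point [s] is kept out of [K] so that a test function may be prescribed
    independently on [K] and at [s]. *)
Lemma compact_approx_off_point (m : {finite_measure set (borelType S) -> \bar R})
    (Q : set (borelType S)) s (e : R) :
  (forall A, measurable A -> (m A <= Defs.total_variation nu A)%E) ->
  measurable Q -> (forall A, measurable A -> A `&` Q = set0 -> m A = 0%E) ->
  0 < e ->
  exists K : set S, [/\ compact K, K `<=` Q `\` [set s] &
    fine (m setT) - fine (m K) - fine (m [set s]) < e].
Proof.
move=> m_le mQ mQ0 e0; have ms := borel_set1 s.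
have mQs : measurable (Q `\` [set s]) by exact: measurableD.
have [K [U [cK oU KQ QU Ue]]] := nu_reg mQs e0.
exists K; split => //.
have mK : measurable (K : set (borelType S)).
  exact: borel_closed (compact_closed (@hausdorff_sep S) cK).
pose D : set (borelType S) := ~` (K `|` [set s]).
have mD : measurable D.
  by apply: measurableC; exact: measurableU.
have mDQ : measurable (D `&` Q) by exact: measurableI.
have mUK : measurable (U `\` K : set (borelType S)).
  by apply: measurableD => //; exact: borel_open.
have msplit : (m setT = m K + m [set s] + m D)%E.
  rewrite -(setUv (K `|` [set s])) measureU//; last first.
  - by rewrite setICr.
  - exact: measurableU.
  rewrite measureU//; apply/disjoints_subset => x Kx xs.
  by case: (KQ x Kx) => _; exact.
have rest : (m D < e%:E)%E.
  apply: le_lt_trans Ue; apply: le_trans (m_le _ mUK).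
  have -> : m D = m (D `&` Q).
    rewrite -[in LHS](setIT D) -(setUv Q) setIUr measureU//; last 2 first.
    - by apply: measurableI => //; exact: measurableC.
    - by rewrite setIACA setICr setI0.
    rewrite [X in (_ + X)%E](_ : _ = 0%E) ?adde0//.
    apply: mQ0; last by rewrite -setIA setICl setI0.
    by apply: measurableI => //; exact: measurableC.
  apply: le_measure; rewrite ?inE// => x [/not_orP [nK ns] Qx]; split => //.
  exact: QU.
have fin A : measurable A -> m A \is a fin_num.
  by move=> mA; exact: fin_num_measure.
rewrite msplit !fineD ?fin_numD ?fin//.
move: rest; rewrite -[X in (X < _)%E]fineK ?fin// lte_fin; lra.
Qed.

(** The bound of [charge_integral_le] is optimal. A nearly optimal [f] is [1] on
    most of the positive Hahn set, [-1] on most of the negative one, and has at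
    [s] the sign of [c + nu({s})]. *)
Lemma charge_integral_approx (c : R) s (e : R) : 0 < e ->
  exists f, (forall x, `|f x| <= 1) /\
    `|c + fine (nu [set s])| + (tvnorm nu - `|fine (nu [set s])|) - e <
      c * f s + charge_integral nu f.
Proof.
(* Each Jordan part loses the mass outside [K] or [L] twice: it is missing from
   the mass of [K] or [L], and the integral over it may have the wrong sign. *)
move=> e0; have e40 : 0 < e / 4 by rewrite divr_gt0.
have [_ _ _ PN0] := hahnP nu.
have [|K [cK KP Ke]] := @compact_approx_off_point pos P s (e / 4) _
  measurable_hahn_pos jordan_pos_disjoint e40.
  by move=> A mA; rewrite /= /charge_variation leeDl.
have [|L [cL LN Le]] := @compact_approx_off_point neg N s (e / 4) _
  measurable_hahn_neg jordan_neg_disjoint e40.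
  by move=> A mA; rewrite /= /charge_variation leeDr.
have closedK := compact_closed (@hausdorff_sep S) cK.
have closedL := compact_closed (@hausdorff_sep S) cL.
pose sg : R := if 0 <= c + fine (nu [set s]) then 1 else -1.
have KL x : K x -> L x -> False.
  move=> /KP[Px _] /LN[Nx _].
  by have : (P `&` N) x by []; rewrite PN0.
have [f [f1 fK fL fs]] : exists f, [/\ (forall x, `|f x| <= 1),
    (forall x, K x -> f x = 1), (forall x, L x -> f x = -1) & f s = sg].
  (* The point [s] joins the compact set on which [f] has the required sign. *)
  pose A : set S := if sg == 1 then K `|` [set s] else K.
  pose B : set S := if sg == 1 then L else L `|` [set s].
  have cA : closed A.
    by rewrite /A; case: ifP => // _; apply: closedU => //; exact: closed_set1.
  have cB : closed B.
    by rewrite /B; case: ifP => // _; apply: closedU => //; exact: closed_set1.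
  have AB0 : A `&` B = set0.
    rewrite /A /B; apply/disjoints_subset => x; case: ifP => _.
    - by case=> [Kx Lx|-> /LN[_]]; [exact: (KL x)|exact].
    - by move=> Kx [/(KL x Kx)//|xs]; case: (KP x Kx) => _; exact.
  have sepAB : uniform_separator A B.
    have nS : normal_space S.
      exact: compact_normal (@hausdorff_sep S) (@compact_space S).
    by move/(@normal_separatorP R): nS; exact.
  pose u : S -> R := Urysohn A B.
  have u01 x : 0 <= u x <= 1.
    have : range u (u x) by exists x.
    by move=> /(@Urysohn_range _ R A B) /=; rewrite in_itv.
  have uA x : A x -> u x = 0 by move=> Ax; apply: (Urysohn_sub0 sepAB); exists x.
  have uB x : B x -> u x = 1 by move=> Bx; apply: (Urysohn_sub1 sepAB); exists x.
  have g_cont : continuous (fun x => 1 - 2 * u x).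
    move=> x; apply: cvgB; first exact: cvg_cst.
    by apply: cvgM; [exact: cvg_cst|exact: Urysohn_continuous].
  pose g : cfun S R := mkcts g_cont.
  have gE x : g x = 1 - 2 * u x by [].
  exists g; split => [x|x Kx|x Lx|]; rewrite gE.
  - by have := u01 x; rewrite ler_norml; lra.
  - by rewrite uA ?mulr0 ?subr0// /A; case: ifP => // _; left.
  - by rewrite uB; [lra|rewrite /B; case: ifP => // _; left].
  - have [sg1|sgN1] : sg = 1 \/ sg = -1 by rewrite /sg; case: ifP; [left|right].
      by rewrite uA ?mulr0 ?subr0// /A sg1 eqxx; right.
    rewrite uB; first by rewrite sgN1; lra.
    by rewrite /B sgN1 eqNr oner_eq0; right.
exists f; split => //.
have est (m : {finite_measure set (borelType S) -> \bar R}) (A : set S) k :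
    closed A -> ~ A s -> (forall x, A x -> f x = k) ->
    `|\int[m]_x f x - (k * fine (m A) + sg * fine (m [set s]))|
      <= fine (m setT) - fine (m A) - fine (m [set s]).
  move=> cA nAs fA; apply: (dist_Rintegral_two_values (cfun_integrable m f)) => //.
  - exact: borel_closed.
  - exact: borel_set1.
  - by apply/disj_setPS => x [Ax /= xs]; apply: nAs; rewrite -xs.
  - by move=> x ->.
have nKs : ~ K s by move=> /KP[_]; exact.
have nLs : ~ L s by move=> /LN[_]; exact.
have := est pos K 1 closedK nKs fK; have := est neg L (-1) closedL nLs fL.
have sgE : sg * (c + fine (nu [set s])) = `|c + fine (nu [set s])|.
  rewrite /sg; case: ifPn => h; first by rewrite mul1r ger0_norm.
  by rewrite mulN1r ltr0_norm// ltNge.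
rewrite -sgE fs norm_atom tvnorm_jordan (fine_jordan (borel_set1 s)).
rewrite /charge_integral !ler_norml; move: Ke Le.
set Ip := \int[pos]_x f x; set In := \int[neg]_x f x.
lra.
Qed.

End jordan.

(** * The norm of a multiple of the identity plus [T] *)

(** The bound [M] guarantees that the supremum defining [opnorm] is a true one. *)
Lemma lt_opnormP (S : compactHausdorffType) (R : realType)
    (F : cfun S R -> cfun S R) (M r : R) :
  (forall f : cfun S R, `|f| <= 1 -> `|F f| <= M) ->
  r < opnorm F <->
    exists (f : cfun S R) (s : S), `|f| <= 1 /\ r < `|F f s|.
Proof.
move=> FM.
have supF : has_sup [set `|F f| | f in [set f : cfun S R | `|f| <= 1]].
  split; first by exists `|F 0|, 0 => //=; rewrite normr0 ler01.
  by exists M => _ [f f1 <-]; exact: FM.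
split=> [rF|[f [s [f1 rf]]]].
- have [_ [f f1 <-] rf] := sup_gt supF.1 rF.
  have [_ [s _ <-] rfs] := sup_gt (has_sup_supnorm (F f)).1 rf.
  by exists f, s.
- apply: lt_le_trans rf _; apply: le_trans (le_supnorm (F f) s) _.
  by apply: ub_le_sup; [exact: supF.2|exists f].
Qed.

Section kernel.
Context (R : realType) (S : compactHausdorffType)
  (T : {linear cfun S R -> cfun S R})
  (mu : S -> {charge set (borelType S) -> \bar R}).
Hypothesis T_bounded : bounded_near T (nbhs (0 : cfun S R)).
Hypothesis mu_kernel : representing_kernel T mu.

Local Notation atom s := (fine (mu s [set s])).

Lemma scale_add_bounded (c : R) :
  exists M, forall f : cfun S R, `|f| <= 1 -> `|c *: f + T f| <= M.
Proof.
move/linear_boundedP: T_bounded => /pinfty_ex_gt0 [r r0 Tr].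
exists (`|c| + r) => f f1; apply: le_trans (ler_normD _ _) _; apply: lerD.
- by rewrite normrZ ler_piMr.
- by apply: le_trans (Tr f) _; rewrite ler_piMr// ltW.
Qed.

(** The norm of the operator is the supremum over [s] of the norms of the
    functionals [c delta_s + mu_s], computed by [charge_integral_le] and
    [charge_integral_approx]. Describing it by the reals below it avoids a side
    condition on that supremum. *)
Lemma lt_opnorm_scale_addP (c r : R) :
  r < opnorm (fun f : cfun S R => c *: f + T f) <->
    exists s, r < `|c + atom s| + (tvnorm (mu s) - `|atom s|).
Proof.
have [M TM] := scale_add_bounded c; have [mu_reg muT] := mu_kernel.
rewrite (lt_opnormP r TM); split=> [[f [s [f1 rf]]]|[s rs]].
- exists s; apply: lt_le_trans rf _; rewrite cfunDE cfunZE -muT.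
  by apply: charge_integral_le => x; exact: le_trans (le_supnorm f x) f1.
- have [f [f1 fs]] := charge_integral_approx (mu_reg s) c s
    (etrans (subr_gt0 _ _) rs).
  exists f, s; split; first exact: supnorm_le.
  rewrite cfunDE cfunZE -muT; apply: lt_le_trans (ler_norm _).
  by move: fs; rewrite subKr.
Qed.

Lemma opnorm_add_scale1 : opnorm (fun f : cfun S R => f + T f) =
  opnorm (fun f : cfun S R => 1 *: f + T f).
Proof. by congr opnorm; apply/funext => f; rewrite scale1r. Qed.

Lemma opnorm_scale0 : opnorm T = opnorm (fun f : cfun S R => 0 *: f + T f).
Proof. by congr opnorm; apply/funext => f; rewrite scale0r add0r. Qed.

Lemma lt_opnorm_kernelP (r : R) :
  r < opnorm T <-> exists s, r < tvnorm (mu s).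
Proof.
rewrite opnorm_scale0 lt_opnorm_scale_addP.
by split=> -[s rs]; exists s; move: rs; rewrite add0r addrC subrK.
Qed.

Lemma tvnorm_le_opnorm s : tvnorm (mu s) <= opnorm T.
Proof.
rewrite leNgt; apply/negP => Ts.
have := (lt_opnorm_kernelP (opnorm T)).2; rewrite ltxx.
by move=> /(_ (ex_intro _ s Ts)).
Qed.

(** With [a = mu_s({s})], the defect [1 - (|1 + a| - |a|)] is [0] for [0 <= a],
    [- 2 a] for [-1 <= a <= 0], and [2] for [a <= -1]. *)
Lemma opnorm_add_eqP : opnorm (fun f : cfun S R => f + T f) = 1 + opnorm T <->
  forall e : R, 0 < e ->
    exists s, opnorm T - e < tvnorm (mu s) /\ - e < atom s.
Proof.
rewrite opnorm_add_scale1; split=> [TE e e0|Te].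
- (* A defect below [1] excludes the regime [a <= -1]. *)
  pose d := Num.min e 1.
  have [d0 [de d1]] : 0 < d /\ d <= e /\ d <= 1.
    by rewrite /d lt_min e0 ltr01 !ge_min !lexx orbT.
  have [|s] := (lt_opnorm_scale_addP 1 (1 + opnorm T - d)).1.
    by rewrite TE; lra.
  have := tvnorm_le_opnorm s; set a := atom s => tv_le h.
  exists s; rewrite -/a; move: h.
  by have [a0|a0] := ger0P a; have [b0|b0] := ger0P (1 + a); split; lra.
- apply/eqP; rewrite eq_le; apply/andP; split; apply/ler_addgt0Pr => e e0.
  + rewrite leNgt; apply/negP => /lt_opnorm_scale_addP [s].
    have := tvnorm_le_opnorm s; have := ler_normD 1 (atom s); rewrite normr1; lra.
  + (* The defect costs at most [2 e / 3], the total variation [e / 3]. *)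
    have e30 : 0 < e / 3 by rewrite divr_gt0.
    have [s [tvs]] := Te _ e30; set a := atom s => ae.
    rewrite -lerBlDr; apply/ltW/lt_opnorm_scale_addP; exists s; rewrite -/a.
    by have [a0|a0] := ger0P a; have [b0|b0] := ger0P (1 + a); lra.
Qed.

(** The supremum condition gives, for each [e], points of [A e] with atom
    above [- d] for all [d > 0]; as [A] shrinks with [e], it is enough to take
    [d = e]. *)
Lemma ereal_sup_atom_ge0P (A : R -> set S) :
  (forall d e, d <= e -> A d `<=` A e) ->
  (forall e : R, 0 < e -> (0 <= ereal_sup [set mu s [set s] | s in A e])%E) <->
  (forall e : R, 0 < e -> exists s, A e s /\ - e < atom s).
Proof.
move=> Amono.
have atomE s : mu s [set s] = (atom s)%:E.
  by rewrite fineK// fin_num_measure//; exact: borel_set1.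
split=> [Ae e e0|Ae e e0].
- have : ((- e)%:E < ereal_sup [set mu s [set s] | s in A e])%E.
    by apply: lt_le_trans (Ae e e0); rewrite lte_fin oppr_lt0.
  by move=> /ereal_sup_gt [_ [s As <-]]; rewrite atomE lte_fin; exists s.
- apply/lee_subgt0Pr => d d0.
  have de : 0 < Num.min d e by rewrite lt_min d0.
  have [s [As ds]] := Ae _ de; rewrite sub0e.
  apply: le_trans (ereal_sup_ubound _); last first.
    by exists s; [apply: Amono As; rewrite ge_min lexx orbT|reflexivity].
  rewrite atomE -EFinN lee_fin; apply: le_trans (ltW ds).
  by rewrite lerN2 ge_min lexx.
Qed.

End kernel.

(** * The two criteria *)

Theorem lemma3 (R : realType) (S : compactHausdorffType)
    (T : {linear cfun S R -> cfun S R})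
    (mu : S -> {charge set (borelType S) -> \bar R})
    (T_bounded : bounded_near T (nbhs (0 : cfun S R)))
    (mu_kernel : representing_kernel T mu) :
  ((forall U : set S, open U -> U !=set0 ->
      (0 <= ereal_sup [set mu s [set s] | s in U])%E) ->
    opnorm (fun f : cfun S R => f + T f) = 1 + opnorm T)
  /\
  (opnorm (fun f : cfun S R => f + T f) = 1 + opnorm T <->
    forall eps : R, 0 < eps ->
      (0 <= ereal_sup [set mu s [set s] | s in
              [set s : S | opnorm T - eps < tvnorm (mu s)]%R])%E).
Proof.
pose A (e : R) := [set s : S | opnorm T - e < tvnorm (mu s)].
have A_mono d e : d <= e -> A d `<=` A e by move=> de s; rewrite /A/=; lra.
have iffA : opnorm (fun f : cfun S R => f + T f) = 1 + opnorm T <->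
    forall e : R, 0 < e -> (0 <= ereal_sup [set mu s [set s] | s in A e])%E.
  by rewrite (ereal_sup_atom_ge0P mu A_mono); exact: opnorm_add_eqP.
split=> // supU; apply/iffA => e e0.
have [M TM] := scale_add_bounded T_bounded 0.
have {}TM (f : cfun S R) : `|f| <= 1 -> `|T f| <= M.
  by move/TM; rewrite scale0r add0r.
have [f [s0 [f1 Tfs0]]] : exists (f : cfun S R) s,
    `|f| <= 1 /\ opnorm T - e < `|T f s|.
  by apply/(lt_opnormP _ TM); lra.
pose U : set S := [set s | opnorm T - e < `|T f s|].
have oU : open U.
  have /continuousP cTf : continuous (fun s => `|T f s|).
    by move=> s; apply: cvg_norm; exact: cfun_continuous.
  exact: (cTf _ (@open_gt R (opnorm T - e))).
apply: le_trans (supU U oU (ex_intro _ s0 Tfs0)) _.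
apply: ereal_sup_le => _ [s Us <-];
  exists s => //; apply: lt_le_trans Us _; rewrite -mu_kernel.2.
by apply: norm_charge_integral_le => x; exact: le_trans (le_supnorm f x) f1.
Qed.
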